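(* (i) Let $(X,d)$ be a locally connected metric space, $f:X\to X$ a continuous map, $n\in\mathbb{N}$ with $n\geq 2$, and $\beta=(m_1,m_2,\dots,m_n)\in\mathbb{N}^n$. If $(X,f)$ is multi-sensitive with respect to $\beta$, then $(X,f)$ is $\beta$-$n$-sensitive. (ii) The converse is not true in general: there exist a locally connected metric space $X$, a continuous map $f:X\to X$, an integer $n\geq 2$ and a vector $\beta\in\mathbb{N}^n$ such that $(X,f)$ is $\beta$-$n$-sensitive but not multi-sensitive with respect to $\beta$.
   Context: $\mathbb{N}=\{1,2,3,\dots\}$. A dynamical system $(X,f)$ is a metric space $(X,d)$ with a continuous map $f:X\to X$; $f^k$ is the $k$-fold composition. For a continuous map $g:X\to X$, $U\subseteq X$ and $\delta>0$, let $N_g(U,\delta)=\{k\in\mathbb{N}: \exists x,y\in U \text{ with } d(g^k(x),g^k(y))>\delta\}$. For $\beta=(m_1,\dots,m_n)\in\mathbb{N}^n$, $n\ge 2$: - $(X,f)$ is multi-sensitive with respect to $\beta$ if there is $\delta>0$ such that for all nonempty open sets $U_1,\dots,U_n\subseteq X$, $\bigcap_{i=1}^n N_{f^{m_i}}(U_i,\delta)\neq\emptyset$. - $(X,f)$ is $\beta$-$n$-sensitive if there is $\delta>0$ such that for every nonempty open $U\subseteq X$ there are $k\in\mathbb{N}$ and $x_1,\dots,x_n\in U$ with $\min_{1\leq i<j\leq n}d(f^{m_ik}(x_i),f^{m_jk}(x_j))>\delta$. *)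

(* Defs.v *)
From mathcomp Require Import all_boot all_order all_algebra.
From mathcomp Require Import boolp classical_sets reals topology.

Set Implicit Arguments.
Unset Strict Implicit.
Unset Printing Implicit Defensive.
Import Order.TTheory GRing.Theory Num.Theory.
Local Open Scope classical_set_scope.
Local Open Scope ring_scope.

Definition locally_connected (X : topologicalType) : Prop :=
  forall (x : X) (U : set X), open U -> U x ->
    exists V : set X, [/\ open V, connected V, V x & V `<=` U].

Section sensitivity.
Context {R : realType} {X : metricType R}.

(* Times and the entries of beta = (m_0, ..., m_(n-1)) range over the positive
   integers: times are constrained in the definitions, entries of beta are to be
   constrained by a hypothesis where the definitions are used. *)

Definition sens_times (g : X -> X) (U : set X) (delta : R) : set nat :=
  [set k | (0 < k)%N /\
    exists x y, [/\ U x, U y & delta < mdist (iter k g x) (iter k g y)]].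

Definition multi_sensitive (f : X -> X) (n : nat) (m : 'I_n -> nat) : Prop :=
  exists2 delta : R, 0 < delta &
    forall U : 'I_n -> set X, (forall i, open (U i) /\ U i !=set0) ->
      (\bigcap_(i in [set: 'I_n]) sens_times (iter (m i) f) (U i) delta) !=set0.

(* The condition min_(i < j) d(..) > delta is spelled out pair by pair; for
   2 <= n the set of pairs is nonempty, so the minimum exists. *)
Definition beta_sensitive (f : X -> X) (n : nat) (m : 'I_n -> nat) : Prop :=
  exists2 delta : R, 0 < delta &
    forall U : set X, open U -> U !=set0 ->
      exists (k : nat) (x : 'I_n -> X),
        [/\ (0 < k)%N, forall i, U (x i) &
            forall i j : 'I_n, (i < j)%N ->
              delta < mdist (iter (m i * k)%N f (x i)) (iter (m j * k)%N f (x j))].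

End sensitivity.

(* Main.v *)
Require Import Defs.
From mathcomp Require Import all_boot all_order all_algebra.
From mathcomp Require Import boolp classical_sets reals topology.
From mathcomp Require Import normedtype lra.

(** (i) Shrink [U] to a connected open [V] and apply multi-sensitivity with every
    [U_i] equal to [V]. The sets [f^(m_i k)(V)] are connected of diameter more
    than [delta], so the distance to one of their points takes on each of them
    all the values [t delta / n] with [t < n]. Points realising these values are
    [delta / n] apart, hence each previously chosen point is [delta / (3 n)]-close
    to at most one of them, and the [x_i] can be chosen greedily.
    (ii) The translation [x + 1] of the real line is an isometry, hence not
    sensitive, but the orbits of a point at the times [k] and [2 k] drift apart. *)

Set Implicit Arguments.
Unset Strict Implicit.
Unset Printing Implicit Defensive.
Import Order.TTheory GRing.Theory Num.Theory.
Import numFieldNormedType.Exports.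
Local Open Scope classical_set_scope.
Local Open Scope ring_scope.

Section metric.
Context {R : realType} {X : metricType R}.

Lemma mdist_continuous (a : X) : continuous (mdist a : X -> R).
Proof.
move=> x; apply/cvgrPdist_lt => e e0.
apply: filterS (nbhsx_ballx x e e0) => y.
rewrite ballEmdist /= => xy.
have t1 := metric_triangle a x y; have t2 := metric_triangle a y x.
have s := metric_sym x y.
by rewrite ltr_norml; apply/andP; split; lra.
Qed.

(** Intermediate value theorem: the continuous image of [A] under [mdist a] is an interval
    containing [0] and [mdist a b]. *)
Lemma connected_mdist_surj (A : set X) (a b : X) (r : R) :
  connected A -> A a -> A b -> 0 <= r <= mdist a b ->
  exists2 p, A p & mdist a p = r.
Proof.
move=> cA Aa Ab rab.
have /connected_intervalP ivl : connected ((mdist a : X -> R) @` A).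
  apply: connected_continuous_connected => //.
  exact/continuous_subspaceT/mdist_continuous.
have [||p Ap <-] := ivl 0 (mdist a b) _ _ r rab; last by exists p.
- by exists a => //; rewrite mdistxx.
- by exists b.
Qed.

(** Pigeonhole: [A] supplies [n] candidates for [p], and each of the [k < n] points [y j] can rule
    out at most one of them. *)
Lemma connected_avoid (A : set X) (a b : X) (n k : nat) (y : 'I_k -> X) (e : R) :
  connected A -> A a -> A b -> 0 < e -> 3 * e * n%:R <= mdist a b -> (k < n)%N ->
  exists2 p, A p & forall j, e < mdist (y j) p.
Proof.
move=> cA Aa Ab e0 eab kn; apply: contrapT => noP.
have /choice[q qP] (t : 'I_n) : exists p, A p /\ mdist a p = 3 * e * t%:R.
  have [|p Ap ap] := @connected_mdist_surj A a b (3 * e * t%:R) cA Aa Ab.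
    apply/andP; split; first by rewrite !mulr_ge0// ltW.
    by apply: le_trans eab; rewrite ler_pM2l ?mulr_gt0// ler_nat ltnW.
  by exists p.
(* If no candidate works, [g t] is the index of a point that rules out [q t]. *)
have /choice[g gP] (t : 'I_n) : exists j, mdist (y j) (q t) <= e.
  apply: contrapT => far; apply: noP; exists (q t); first exact: (qP t).1.
  by move=> j; rewrite ltNge; apply/negP => le_e; apply: far; exists j.
suff /leq_card : injective g by rewrite !card_ord leqNgt kn.
(* A shared index would put [q s] and [q t] within [2 * e] of each other, while their distances to
   [a] differ by at least [3 * e]. *)
have sep (s t : 'I_n) : (s < t)%N -> g s <> g t.
  move=> st gst; have := gP t; have := gP s; rewrite gst => ys yt.
  have t1 := metric_triangle a (q s) (q t).
  have t2 := metric_triangle (q s) (y (g t)) (q t).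
  rewrite (metric_sym (q s) (y _)) in t2; rewrite !(proj2 (qP _)) in t1.
  have st1 : s%:R + 1 <= t%:R :> R by rewrite natr1 ler_nat.
  have : 3 * e * (s%:R + 1) <= 3 * e * t%:R by rewrite ler_pM2l ?mulr_gt0.
  lra.
move=> s t gst; apply: val_inj => /=.
by case: (ltngtP s t) => // [/sep/(_ gst)|/sep/(_ (esym gst))].
Qed.

Lemma connected_separated (n : nat) (A : 'I_n -> set X) (e : R) :
  0 < e -> (forall i, connected (A i)) ->
  (forall i, exists a b, [/\ A i a, A i b & 3 * e * n%:R <= mdist a b]) ->
  exists x : 'I_n -> X, (forall i, A i (x i)) /\
    forall i j : 'I_n, (i < j)%N -> e < mdist (x i) (x j).
Proof.
move=> e0 cA /choice[a /choice[b ab]].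
(* Greedy choice: only the entries below [l] are settled. The others are placeholders, initially
   taken from [a], and each step replaces the entry [l] alone. *)
have step l : (l <= n)%N -> exists x : 'I_n -> X, (forall i, A i (x i)) /\
    forall i j : 'I_n, (i < j)%N -> (j < l)%N -> e < mdist (x i) (x j).
  elim: l => [_|l IHl ln].
    by exists a; split=> // i; case: (ab i).
  have [x [Ax xP]] := IHl (ltnW ln).
  have [Aa Ab dab] := ab (Ordinal ln).
  have [p Ap pP] := connected_avoid
    (fun j => x (widen_ord (ltnW ln) j)) (cA _) Aa Ab e0 dab ln.
  exists (fun i => if i == Ordinal ln then p else x i); split.
    by move=> i; case: eqP => [->|].
  move=> i j ij; rewrite ltnS leq_eqVlt => /orP[/eqP jl|jl].
    have -> : j == Ordinal ln by apply/eqP/val_inj.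
    have il : (i < l)%N by rewrite -jl.
    rewrite -val_eqE /= (ltn_eqF il).
    by have := pP (Ordinal il); congr (_ < mdist (x _) _); exact: val_inj.
  by rewrite -!val_eqE /= (ltn_eqF jl) (ltn_eqF (ltn_trans ij jl)); exact: xP.
have [x [Ax xP]] := step n (leqnn n).
by exists x; split=> // i j ij; exact: xP.
Qed.

Lemma iter_continuous (f : X -> X) (k : nat) :
  continuous f -> continuous (iter k f).
Proof.
move=> cf; elim: k => [|k IHk] x; first exact: cvg_id.
by apply: (@continuous_comp _ _ _ (iter k f) f); [exact: IHk|exact: cf].
Qed.

Lemma multi_sensitive_beta (f : X -> X) (n : nat) (m : 'I_n -> nat) :
  locally_connected X -> continuous f -> (0 < n)%N ->
  multi_sensitive f m -> beta_sensitive f m.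
Proof.
move=> lcX cf n0 [d d0 dP].
have n0R : 0 < n%:R :> R by rewrite ltr0n.
have e0 : 0 < d / (3 * n%:R) by rewrite divr_gt0// mulr_gt0.
(* With this [e], the diameter [3 * e * n] required for the separation is exactly [d]. *)
exists (d / (3 * n%:R)) => // U oU [u Uu].
have [V [oV cV Vu VU]] := lcX u U oU Uu.
have [|k kP] := dP (fun=> V); first by move=> i; split=> //; exists u.
have [||z [Az zP]] :=
    @connected_separated n (fun i => iter (m i * k) f @` V) _ e0.
- move=> i; apply: connected_continuous_connected => //.
  exact/continuous_subspaceT/iter_continuous.
- move=> i; have [_ [x [y [Vx Vy xy]]]] := kP i I.
  exists (iter (m i * k) f x), (iter (m i * k) f y); split; [by exists x|by exists y|].
  rewrite mulnC !iterM (le_trans _ (ltW xy))//.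
  by rewrite mulrAC mulrC divfK// mulf_neq0// gt_eqF.
have /choice[x xP] i : exists x, V x /\ iter (m i * k) f x = z i.
  by have [x Vx xz] := Az i; exists x.
exists k, x; split.
(* Positivity of [k] is part of [sens_times], so it is read off at the index [0]. *)
- by case: (kP (Ordinal n0) I).
- by move=> i; apply: VU; case: (xP i).
- by move=> i j ij; rewrite (xP i).2 (xP j).2; exact: zP.
Qed.

End metric.

Section translation.
Context {R : realType}.

Let shift1 (x : R^o) : R^o := x + 1.

Lemma locally_connected_real : locally_connected (R^o : metricType R).
Proof.
move=> x U oU Ux.
have /nbhs_ballP[e e0 eU] : nbhs x U by exact: open_nbhs_nbhs.
exists (ball x e); split=> //.
- exact: ball_open.
- by rewrite ball_itv; exact/connected_intervalP/interval_is_interval.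
- exact: ballxx.
Qed.

Lemma shift1_continuous : continuous shift1.
Proof. by move=> x; apply: cvgD; [exact: cvg_id|exact: cvg_cst]. Qed.

Lemma iter_shift1 (k : nat) (x : R^o) : iter k shift1 x = x + k%:R.
Proof.
by elim: k => [|k IHk]; rewrite ?addr0//= IHk /shift1 -addrA natr1.
Qed.

(** Already at [k = 1], with all [x i] equal to one point [u], the images [u + i.+1] are at least
    [1] apart; any constant below [1] would do. *)
Lemma shift1_beta (n : nat) :
  beta_sensitive (X := R^o) shift1 (fun i : 'I_n => i.+1).
Proof.
exists (2^-1) => [|]; first by rewrite invr_gt0.
move=> U _ [u Uu]; exists 1%N, (fun=> u); split=> // i j ij.
rewrite !iter_shift1 !muln1 /mdist /= opprD addrACA subrr add0r.
have ij1 : i.+1%:R + 1 <= j.+1%:R :> R by rewrite natr1 ler_nat.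
rewrite (lt_le_trans _ (ler_norm _))//; lra.
Qed.

(** Translations preserve distances, so two points of a ball of radius [d / 2] never get more than
    [d] apart; a single index gives the contradiction. *)
Lemma shift1_not_multi (n : nat) (m : 'I_n -> nat) :
  (0 < n)%N -> ~ multi_sensitive (X := R^o) shift1 m.
Proof.
move=> n0 [d d0 dP].
have d20 : 0 < d / 2 by rewrite divr_gt0.
have [|k kP] := dP (fun=> ball (0 : R^o) (d / 2)).
  by move=> i; split; [exact: ball_open|exists 0; exact: ballxx].
have [_ [x [y []]]] := kP (Ordinal n0) I.
rewrite !ballEmdist -!iterM !iter_shift1 /mdist /= => x0 y0.
rewrite !subr0 in x0 y0.
rewrite opprD addrACA subrr addr0 => dxy.
have := ler_normB y x; lra.
Qed.

End translation.

Theorem theorem1 (R : realType) :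
  (forall (X : metricType R) (f : X -> X) (n : nat) (m : 'I_n -> nat),
      locally_connected X -> continuous f ->
      (2 <= n)%N -> (forall i, (0 < m i)%N) ->
      multi_sensitive f m -> beta_sensitive f m) /\
  (exists (X : metricType R) (f : X -> X) (n : nat) (m : 'I_n -> nat),
      [/\ locally_connected X, continuous f,
          (2 <= n)%N & forall i, (0 < m i)%N] /\
      (beta_sensitive f m /\ ~ multi_sensitive f m)).
Proof.
split=> [X f n m lcX cf n2 _|].
  exact: (multi_sensitive_beta lcX cf (ltnW n2)).
(* Ordinals start at [0], so this is the vector [(1, 2)]. *)
exists R^o, (fun x => x + 1), 2%N, (fun i => i.+1); split.
  by split=> //; [exact: locally_connected_real|exact: shift1_continuous].
by split; [exact: shift1_beta|exact: shift1_not_multi].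
Qed.
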